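(* Let $(X,\mathcal{K})$ be a connectivity space (not necessarily integral), and regard the ordered set $(\mathcal{K},\subset)$ as a category, still denoted $\mathcal{K}$. For every $A\in\mathcal{K}$, let $J(A)$ be the set of sieves $c$ on $A$ such that $[c]_0=\mathcal{K}_{\vert A}$. Then the assignment $A\mapsto J(A)$ is a Grothendieck topology on the category $\mathcal{K}$.
   Context: A connectivity space is a pair $(X,\mathcal{K})$ where $X$ is a set and $\mathcal{K}$ is a set of subsets of $X$ (called the connected subsets; $\mathcal{K}$ is called a connectivity structure on $X$) such that $\emptyset\in\mathcal{K}$ and, for every nonempty family $\mathcal{F}\subset\mathcal{K}$ with $\bigcap_{F\in\mathcal{F}}F\neq\emptyset$, one has $\bigcup_{F\in\mathcal{F}}F\in\mathcal{K}$. The space is called integral if moreover every singleton of $X$ belongs to $\mathcal{K}$; this is not assumed here. For a set $c$ of subsets of $X$, $[c]_0$ denotes the (not necessarily integral) connectivity structure generated by $c$, i.e. the smallest connectivity structure on $X$ containing $c$; in particular $\emptyset\in[c]_0$ always. The category $\mathcal{K}$ has the connected subsets as objects, with exactly one arrow $B\to A$ if $B\subset A$ and none otherwise. A sieve on $A\in\mathcal{K}$ is identified with the set of domains of its arrows, i.e. with a set $c$ of elements of $\mathcal{K}$ contained in $A$ such that $B\in c$, $B'\in\mathcal{K}$ and $B'\subset B$ imply $B'\in c$ (the empty set of arrows is a sieve). For $A\in\mathcal{K}$, $\mathcal{K}_{\vert A}=\mathcal{K}\cap\mathcal{P}(A)$ is the induced connectivity structure on $A$, which is the maximal sieve on $A$.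 The restriction of a sieve $c$ on $A$ to $B\subset A$, $B\in\mathcal{K}$, is $\{C\in c : C\subset B\}$. *)

(* Defs.v *)
From mathcomp Require Import all_boot.
From mathcomp Require Import boolp classical_sets.

Set Implicit Arguments.
Unset Strict Implicit.
Unset Printing Implicit Defensive.

Local Open Scope classical_set_scope.

Record category : Type := Category {
  obj :> Type;
  hom : obj -> obj -> Type;
  idmap : forall A, hom A A;
  (* [comp f g] is "f after g". *)
  comp : forall A B C, hom B C -> hom A B -> hom A C;
  comp_idl : forall A B (f : hom A B), comp (idmap B) f = f;
  comp_idr : forall A B (f : hom A B), comp f (idmap A) = f;
  comp_assoc : forall A B C D (f : hom C D) (g : hom B C) (h : hom A B),
    comp f (comp g h) = comp (comp f g) h
}.

Record sieve (C : category) (A : C) : Type := Sieve {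
  arrows : forall B : C, set (hom B A);
  arrows_comp : forall (B B' : C) (f : hom B A) (g : hom B' B),
    arrows f -> arrows (comp f g)
}.

Definition max_sieve (C : category) (A : C) : sieve A :=
  @Sieve C A (fun B => [set: hom B A]) (fun _ _ _ _ _ => I).

Lemma pullback_arrows_comp (C : category) (A B : C) (h : hom B A)
    (S : sieve A) (D D' : C) (f : hom D B) (g : hom D' D) :
  arrows S (comp h f) -> arrows S (comp h (comp f g)).
Proof. by move=> Sf; rewrite comp_assoc; apply: arrows_comp. Qed.

(* For a thin category this is the restriction of [S] to the domain of [h]. *)
Definition pullback_sieve (C : category) (A B : C) (h : hom B A)
    (S : sieve A) : sieve B :=
  @Sieve C B (fun D => [set f : hom D B | arrows S (comp h f)])
    (@pullback_arrows_comp C A B h S).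

Definition sieve_domains (C : category) (A : C) (S : sieve A) : set C :=
  [set B | exists f : hom B A, arrows S f].

Record grothendieck_topology (C : category)
    (J : forall A : C, set (sieve A)) : Prop := GrothendieckTopology {
  gt_maximal : forall A : C, J A (max_sieve A);
  gt_stable : forall (A B : C) (h : hom B A) (S : sieve A),
    J A S -> J B (pullback_sieve h S);
  gt_transitive : forall (A : C) (S R : sieve A),
    J A S ->
    (forall (B : C) (h : hom B A), arrows S h -> J B (pullback_sieve h R)) ->
    J A R
}.

Definition connectivity (X : Type) (K : set (set X)) : Prop :=
  K set0 /\
  forall F : set (set X), F `<=` K -> F !=set0 ->
    \bigcap_(A in F) A !=set0 -> K (\bigcup_(A in F) A).

(* [c]_0; [smallest P c] is the intersection of all the supersets of [c]
   that satisfy [P]. *)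
Definition generated (X : Type) (c : set (set X)) : set (set X) :=
  smallest (@connectivity X) c.

Definition induced (X : Type) (K : set (set X)) (A : set X) : set (set X) :=
  K `&` [set B | B `<=` A].

(* An arrow from B to A is a proof of [B `<=` A], unique by proof
   irrelevance. *)
Definition connected_category (X : Type) (K : set (set X)) : category :=
  @Category {A : set X | K A}
    (fun B A => sval B `<=` sval A)
    (fun A => @subset_refl X (sval A))
    (fun A B C BC AB => subset_trans AB BC)
    (fun _ _ _ => Prop_irrelevance _ _)
    (fun _ _ _ => Prop_irrelevance _ _)
    (fun _ _ _ _ _ _ _ => Prop_irrelevance _ _).

Definition sieve_subsets (X : Type) (K : set (set X))
    (A : connected_category K) (S : sieve A) : set (set X) :=
  [set sval B | B in sieve_domains S].

Definition generating_sieves (X : Type) (K : set (set X))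
    (A : connected_category K) : set (sieve A) :=
  [set S | generated (sieve_subsets S) = induced K (sval A)].

(* Main.v *)
Require Import Defs.
From mathcomp Require Import all_boot.
From mathcomp Require Import boolp classical_sets.

Set Implicit Arguments.
Unset Strict Implicit.
Unset Printing Implicit Defensive.

Local Open Scope classical_set_scope.

(** A sieve on [A] covers as soon as it generates every connected subset of [A]
    ([generating_sievesP]). The maximal sieve does so trivially. Stability rests on
    [generated_induced]: generation proceeds by unions, so a generated set lying in [B] only needs
    generators lying in [B]. Transitivity holds because [[_]_0] is a closure operator: if [R]
    restricted to each member [B] of [S] generates [B], then [[R]_0] contains [S], hence [[S]_0]. *)

Lemma generated_connectivity (X : Type) (c : set (set X)) :
  connectivity (generated c).
Proof.
split=> [L [[L0 _] _]|F Fc Fn0 In0 L [Lconn cL]]; first exact: L0.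
by apply: Lconn.2 => // B /Fc; apply.
Qed.

Lemma sub_generated (X : Type) (c : set (set X)) : c `<=` generated c.
Proof. exact: sub_gen_smallest. Qed.

Lemma generated_sub (X : Type) (c L : set (set X)) :
  connectivity L -> c `<=` L -> generated c `<=` L.
Proof. exact: smallest_sub. Qed.

Lemma generated_mono (X : Type) (c c' : set (set X)) :
  c `<=` c' -> generated c `<=` generated c'.
Proof.
move=> cc'; apply: generated_sub; first exact: generated_connectivity.
exact: subset_trans cc' (@sub_generated X c').
Qed.

Lemma induced_connectivity (X : Type) (K : set (set X)) (A : set X) :
  connectivity K -> connectivity (induced K A).
Proof.
move=> [K0 KU]; split=> [|F FKA Fn0 In0]; first by split=> //; apply: sub0set.
split; first by apply: KU => // B /FKA[].
by apply: bigcup_sub => B /FKA[].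
Qed.

(* The sets whose inclusion in [B] forces them to lie in [generated (induced c B)]
   form a connectivity structure: a union lies in [B] only if all its members do. *)
Lemma generated_induced (X : Type) (c : set (set X)) (B : set X) :
  induced (generated c) B `<=` generated (induced c B).
Proof.
pose L := [set D | D `<=` B -> generated (induced c B) D].
have [G0 GU] := generated_connectivity (induced c B).
have Lconn : connectivity L.
  split=> [_ //|F FL Fn0 In0 UB]; apply: GU => // D FD.
  by apply: (FL D FD); apply: subset_trans UB; apply: bigcup_sup.
suff GL : generated c `<=` L by move=> D [/GL]; apply.
by apply: generated_sub => // D cD DB; apply: sub_generated.
Qed.

Section SieveSubsets.
Variables (X : Type) (K : set (set X)).
Implicit Types A B : connected_category K.

Lemma sieve_subsets_induced A (S : sieve A) :
  sieve_subsets S `<=` induced K (sval A).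
Proof. by move=> _ [B [BA _] <-]; split=> //; apply: (svalP B). Qed.

Lemma sieve_subsets_max A :
  sieve_subsets (max_sieve A) = induced K (sval A).
Proof.
apply/seteqP; split=> [|D [KD DA]]; first exact: sieve_subsets_induced.
by exists (exist _ D KD) => //; exists DA.
Qed.

Lemma sieve_subsets_pullback A B (h : hom B A) (S : sieve A) :
  sieve_subsets (pullback_sieve h S) = induced (sieve_subsets S) (sval B).
Proof.
apply/seteqP; split=> [_ [D [DB SD] <-]|_ [[D [DA SD] <-] DB]].
  by split=> //; exists D => //; exists (subset_trans DB h).
exists D => //; exists DB => /=.
(* Membership in [S] is a property of arrows, so the composite through [B] must be identified with
   the given arrow [DA]. *)
by rewrite (Prop_irrelevance (subset_trans _ _) DA).
Qed.

(** The reverse inclusion is automatic: [induced K (sval A)] is a connectivity structure containing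
    the sieve. *)
Lemma generating_sievesP (hK : connectivity K) A (S : sieve A) :
  generating_sieves S <->
  induced K (sval A) `<=` generated (sieve_subsets S).
Proof.
split=> [-> //|KS]; apply/seteqP; split=> //.
apply: generated_sub; first exact: induced_connectivity.
exact: sieve_subsets_induced.
Qed.

End SieveSubsets.

Theorem mainTheorem1 (X : Type) (K : set (set X)) (hK : connectivity K) :
  grothendieck_topology (@generating_sieves X K).
Proof.
split=> [A|A B h S /generating_sievesP KS|A S R /generating_sievesP KS SR];
  apply/generating_sievesP => //.
- by rewrite sieve_subsets_max; apply: sub_generated.
- rewrite sieve_subsets_pullback => D [KD DB]; apply: generated_induced.
  by split=> //; apply: KS => //; split=> //; apply: subset_trans h.
- apply: subset_trans (KS hK) _; apply: generated_sub.
    exact: generated_connectivity.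
  move=> _ [B [h Sh] <-].
  have /(generating_sievesP hK) KR := SR B h Sh.
  (* The covering condition over [B] is applied only to [B] itself, as the largest element of
     [induced K (sval B)]. *)
  have : generated (sieve_subsets (pullback_sieve h R)) (sval B).
    by apply: KR; split=> //; apply: (svalP B).
  by apply: generated_mono; rewrite sieve_subsets_pullback => D [].
Qed.
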